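(* Let $k$ be an infinite field, let $d\ge 4$ be an even integer, let $R=k[x_1,\ldots,x_d]_{(x_1,\ldots,x_d)}$ with maximal ideal $\mathfrak{m}$, and let $I=(e_1,\ldots,e_d)\subset R$ be the edge ideal of the cycle of length $d$, where $e_i=x_ix_{i+1}$ for $1\le i<d$ and $e_d=x_1x_d$. Then $\mathrm{core}(I)=\mathrm{gradedcore}(I)=\mathfrak{m}I$.
   Context: A reduction of an ideal $I$ is an ideal $J\subset I$ with $I^{r+1}=JI^r$ for some integer $r\ge 0$; a minimal reduction is a reduction that is minimal with respect to inclusion among reductions of $I$. The core of $I$, $\mathrm{core}(I)$, is the intersection of all reductions of $I$; over a Noetherian local ring it equals the intersection of all minimal reductions. A minimal reduction is homogeneous if it is generated by (images in $R$ of) homogeneous polynomials, and $\mathrm{gradedcore}(I)$ is the intersection of all homogeneous minimal reductions of $I$. *)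

(* Defs.v *)
From HB Require Import structures.
From mathcomp Require Import all_boot all_order all_algebra fraction.
From mathcomp Require Import mpoly.
From mathcomp Require Import boolp classical_sets cardinality.

Set Implicit Arguments.
Unset Strict Implicit.
Unset Printing Implicit Defensive.

Import GRing.Theory.

Local Open Scope classical_set_scope.
Local Open Scope ring_scope.

Section Ideals.
Variable A : comNzRingType.
Implicit Types I J : set A.

Definition is_ideal J : Prop :=
  [/\ J 0, (forall a b, J a -> J b -> J (a + b))
         & (forall r a, J a -> J (r * a))].

Definition ideal_gen (S : set A) : set A := smallest is_ideal S.

Definition ideal_mul I J : set A :=
  ideal_gen [set c | exists a b, [/\ I a, J b & c = a * b]].

Fixpoint ideal_exp I (n : nat) : set A :=
  if n is n'.+1 then ideal_mul I (ideal_exp I n') else setT.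

Definition is_reduction I J : Prop :=
  [/\ is_ideal J, J `<=` I
    & exists r : nat, ideal_exp I r.+1 = ideal_mul J (ideal_exp I r)].

Definition is_minimal_reduction I J : Prop :=
  is_reduction I J /\
  forall J', is_reduction I J' -> J' `<=` J -> J' = J.

Definition core I : set A := \bigcap_(J in is_reduction I) J.

Lemma is_ideal_gen (S : set A) : is_ideal (ideal_gen S).
Proof.
split=> [J [[]] //|a b Ha Hb J HJ|r a Ha J HJ].
  by have [[_ JD _] _] := HJ; apply: JD; [exact: Ha|exact: Hb].
by have [[_ _ JM] _] := HJ; apply: JM; exact: Ha.
Qed.

End Ideals.

Section LocalRing.
Variables (k : fieldType) (n : nat).

Definition origin_ideal : set {mpoly k[n]} := ideal_gen (range (fun i => 'X_i)).

Lemma origin_idealE : origin_ideal = [set f | f@_0%MM = 0].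
Proof.
apply/seteqP; split=> f /=.
  move/(_ [set f | f@_0%MM = 0]); apply; split; last by move=> _ [i _ <-] /=; rewrite mcoeffX mnm1_eq0.
  split=> [|a b /= a0 b0|r a /= a0]; first by rewrite /= mcoeff0.
    by rewrite mcoeffD a0 b0 addr0.
  by rewrite (rmorphM (mcoeff 0%MM)) /= a0 mulr0.
have [o0 oD oM] := is_ideal_gen (range (fun i => 'X_i : {mpoly k[n]})).
move=> f0; rewrite [f]mpolyE big_seq; apply: (big_ind origin_ideal) => // m fm.
have [m0|/eqP] := eqVneq m 0%MM; first by rewrite m0 f0 scale0r.
move/eqP; rewrite -mdeg_eq0 mdegE sum_nat_eq0 negb_forall => /existsP[i /= mi].
have -> : m = ((m - U_(i)) + U_(i))%MM.
  by rewrite submK //; apply/mnm_lepP => j; rewrite mnm1E; case: eqP => // <-;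
    rewrite lt0n.
rewrite mpolyXD scalerAl; apply: oM.
by apply: sub_gen_smallest; exists i.
Qed.

Definition localization_pred : pred {fraction {mpoly k[n]}} :=
  fun a => `[< exists f g : {mpoly k[n]},
     ~ origin_ideal g /\ a = FracField.tofrac f / FracField.tofrac g >].

Lemma notin_origin_neq0 (g : {mpoly k[n]}) :
  ~ origin_ideal g -> FracField.tofrac g != 0.
Proof.
rewrite origin_idealE /= tofrac_eq0 => g0.
by apply/eqP => gE; apply: g0; rewrite gE mcoeff0.
Qed.

Lemma notin_originM (g h : {mpoly k[n]}) :
  ~ origin_ideal g -> ~ origin_ideal h -> ~ origin_ideal (g * h).
Proof.
rewrite origin_idealE /= (rmorphM (mcoeff 0%MM)) /= => /eqP g0 /eqP h0.
by apply/eqP; rewrite mulf_neq0.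
Qed.

Lemma notin_origin1 : ~ origin_ideal 1.
Proof. by rewrite origin_idealE /= mcoeff1 eqxx; apply/eqP/oner_neq0. Qed.

Lemma localization_pred_tofrac (f : {mpoly k[n]}) :
  localization_pred (FracField.tofrac f).
Proof.
apply/asboolP; exists f, 1; split; first exact: notin_origin1.
by rewrite tofrac1 divr1.
Qed.

Lemma localization_pred_subring : subring_closed localization_pred.
Proof.
split.
- by have := localization_pred_tofrac 1; rewrite tofrac1.
- move=> _ _ /asboolP[f [g [g0 ->]]] /asboolP[f' [g' [g'0 ->]]]; apply/asboolP.
  exists (f * g' - f' * g), (g * g'); split; first exact: notin_originM.
  by rewrite tofracB !tofracM -mulNr addf_div ?notin_origin_neq0// mulNr.
- move=> _ _ /asboolP[f [g [g0 ->]]] /asboolP[f' [g' [g'0 ->]]]; apply/asboolP.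
  exists (f * f'), (g * g'); split; first exact: notin_originM.
  by rewrite !tofracM mulf_div.
Qed.

HB.instance Definition _ :=
  GRing.isSubringClosed.Build {fraction {mpoly k[n]}} localization_pred
    localization_pred_subring.

(* The local ring k[x_1, ..., x_n]_(x_1, ..., x_n), as the subring of its field
   of fractions formed by the f / g with g outside (x_1, ..., x_n). *)
Record localPoly := LocalPoly {
  localPoly_val :> {fraction {mpoly k[n]}};
  _ : localPoly_val \in localization_pred }.

HB.instance Definition _ := [isSub for localPoly_val].
HB.instance Definition _ := [Choice of localPoly by <:].
HB.instance Definition _ := [SubChoice_isSubComNzRing of localPoly by <:].

Definition toLocal (f : {mpoly k[n]}) : localPoly :=
  LocalPoly (localization_pred_tofrac f).

Definition maximal_ideal : set localPoly :=
  ideal_gen (range (fun i => toLocal 'X_i)).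

Lemma toLocal_zmod_morphism : zmod_morphism toLocal.
Proof. by move=> f g; apply: val_inj; rewrite /= tofracB. Qed.

Lemma toLocal_monoid_morphism : monoid_morphism toLocal.
Proof.
by split=> [|f g]; apply: val_inj; rewrite /= ?tofrac1 // tofracM.
Qed.

HB.instance Definition _ :=
  GRing.isZmodMorphism.Build {mpoly k[n]} localPoly toLocal
    toLocal_zmod_morphism.
HB.instance Definition _ :=
  GRing.isMonoidMorphism.Build {mpoly k[n]} localPoly toLocal
    toLocal_monoid_morphism.

(* [localPoly] is local with maximal ideal [maximal_ideal]. *)
Lemma maximal_idealE :
  maximal_ideal = [set a | ~ exists b, a * b = 1].
Proof.
have locP (a : localPoly) : exists f g : {mpoly k[n]},
    ~ origin_ideal g /\ val a = FracField.tofrac f / FracField.tofrac g.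
  by case: a => a /= /asboolP.
have nonunit (f g : {mpoly k[n]}) (a : localPoly) : ~ origin_ideal g ->
    val a = FracField.tofrac f / FracField.tofrac g ->
    (exists b, a * b = 1) <-> ~ origin_ideal f.
  move=> g0 aE; split=> [[b ab1] f0|f0].
    have [f' [g' [g'0 bE]]] := locP b.
    have : FracField.tofrac (f * f') = FracField.tofrac (g * g').
      move: ab1 => /(congr1 val) /=; rewrite aE bE mulf_div -!tofracM => /eqP.
      rewrite -[1](divr1) eqr_div ?oner_neq0 ?notin_origin_neq0//; last exact: notin_originM.
      by rewrite mulr1 mul1r => /eqP.
    move/eqP; rewrite tofrac_eq => /eqP fg; apply: (notin_originM g0 g'0).
    move: f0; rewrite -fg origin_idealE /= (rmorphM (mcoeff 0%MM)) /= => ->.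
    by rewrite mul0r.
  have bP : localization_pred (FracField.tofrac g / FracField.tofrac f).
    by apply/asboolP; exists g, f.
  exists (LocalPoly bP); apply: val_inj; rewrite /= aE mulf_div.
  by rewrite [X in _ / X]mulrC divff // mulf_neq0 // notin_origin_neq0.
have [m0 mD mM] := is_ideal_gen (range (fun i => toLocal 'X_i)).
apply/seteqP; split=> a /=.
- pose M : set localPoly := [set a | exists f g : {mpoly k[n]},
    [/\ origin_ideal f, ~ origin_ideal g &
       val a = FracField.tofrac f / FracField.tofrac g]].
  have -> : (~ exists b, a * b = 1) = M a.
    apply/propext; split=> /= [na|[f [g [f0 g0 aE]]]].
      have [f [g [g0 aE]]] := locP a; exists f, g; split=> //.
      by apply: contrapT => /(nonunit _ _ _ g0 aE).
    by move/(nonunit _ _ _ g0 aE).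
  move/(_ M); apply; split.
    have [o0 oD oM] := is_ideal_gen (range (fun i => 'X_i : {mpoly k[n]})).
    split.
    + exists 0, 1; split=> //; first exact: notin_origin1.
      by rewrite tofrac0 mul0r.
    + move=> b c [f [g [f0 g0 bE]]] [f' [g' [f'0 g'0 cE]]].
      exists (f * g' + f' * g), (g * g'); split; last 1 first.
      * by rewrite /= bE cE tofracD !tofracM addf_div ?notin_origin_neq0.
      * by apply: oD; rewrite mulrC; exact: oM.
      * exact: notin_originM.
    + move=> r c [f [g [f0 g0 cE]]]; have [f' [g' [g'0 rE]]] := locP r.
      exists (f' * f), (g' * g); split; first exact: oM.
        exact: notin_originM.
      by rewrite /= rE cE !tofracM mulf_div.
  move=> _ [i _ <-]; exists 'X_i, 1; split; last by rewrite tofrac1 divr1.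
    by apply: sub_gen_smallest; exists i.
  exact: notin_origin1.
- have [f [g [g0 aE]]] := locP a => /(contra_not (nonunit _ _ _ g0 aE).2).
  move=> /contrapT f0.
  have mf : maximal_ideal (toLocal f).
    apply: (f0 [set h | maximal_ideal (toLocal h)]); split; last first.
      by move=> _ [i _ <-]; apply: sub_gen_smallest; exists i.
    split=> [|b c|r b] /=; rewrite ?rmorph0 ?rmorphD ?rmorphM //; first exact: mD.
    exact: mM.
  have bP : localization_pred (FracField.tofrac 1 / FracField.tofrac g).
    by apply/asboolP; exists 1, g.
  have -> : a = LocalPoly bP * toLocal f.
    by apply: val_inj; rewrite /= aE tofrac1 mul1r mulrC.
  exact: mM.
Qed.

Definition homogeneous_ideal (J : set localPoly) : Prop :=
  exists2 S : set {mpoly k[n]},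
    (forall f, S f -> exists e : nat, f \is e.-homog) &
    J = ideal_gen (toLocal @` S).

Definition gradedcore (I : set localPoly) : set localPoly :=
  \bigcap_(J in [set J | is_minimal_reduction I J /\ homogeneous_ideal J]) J.

(* [ordS] is the cyclic successor, so the last generator is 'X_(n-1) * 'X_0. *)
Definition cycle_edge_ideal : set localPoly :=
  ideal_gen (range (fun i : 'I_n => toLocal ('X_i * 'X_(ordS i)))).

End LocalRing.

Arguments maximal_ideal : clear implicits.
Arguments cycle_edge_ideal : clear implicits.

(* Main.v *)
Require Import Defs.
From HB Require Import structures.
From mathcomp Require Import all_boot all_order all_algebra fraction.
From mathcomp Require Import mpoly.
From mathcomp Require Import boolp classical_sets cardinality.
From mathcomp Require Import ring zify.

(* Write d = 2D and call a point p of k^d good when the products of its even and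
   of its odd coordinates differ, i.e. when p lies off the toric hypersurface
   prod T_(2s) = prod T_(2s+1) that presents the fiber ring of I.

   Let J be a reduction of I and V its image in I / mI = k^d.  Evaluating initial
   forms at points of the hypersurface shows that no nonzero vector orthogonal to
   V lies on it, even after extending scalars.  A line always meets the
   hypersurface over some extension of k, so the orthogonal of V has dimension at
   most 1, and V contains all v with v.p = 0 for some good p.  Thus J contains
   p_j e_i - p_i e_j modulo mI for all i, j.  Since x_i e_(i+1) = x_(i+2) e_i,
   going around the cycle in steps of 2 multiplies by the ratio of the two
   alternating products of p, which forces all x_l e_i into J + m(mI), and
   Nakayama's lemma gives mI <= J.

   Conversely, for every good p the ideal (p_j e_i - p_i e_j) is a homogeneous
   minimal reduction, and good points span k^d, so the intersection of these
   ideals is contained in mI. *)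

Set Implicit Arguments.
Unset Strict Implicit.
Unset Printing Implicit Defensive.

Import GRing.Theory.

Local Open Scope classical_set_scope.
Local Open Scope ring_scope.

(** * Ideals and the lemma of Nakayama *)

Section IdealTheory.
Variable A : comNzRingType.
Implicit Types (I J K S : set A) (a b c x y z : A) (s : seq A).

Lemma is_ideal0 J : is_ideal J -> J 0. Proof. by case. Qed.

Lemma is_idealD J a b : is_ideal J -> J a -> J b -> J (a + b).
Proof. by case=> _ + _; apply. Qed.

Lemma is_idealMl J r a : is_ideal J -> J a -> J (r * a).
Proof. by case=> _ _; apply. Qed.

Lemma is_idealMr J r a : is_ideal J -> J a -> J (a * r).
Proof. by rewrite mulrC; apply: is_idealMl. Qed.

Lemma is_idealN J a : is_ideal J -> J a -> J (- a).
Proof. by move=> iJ Ja; rewrite -mulN1r; apply: is_idealMl. Qed.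

Lemma is_idealB J a b : is_ideal J -> J a -> J b -> J (a - b).
Proof. by move=> iJ Ja Jb; apply: is_idealD => //; apply: is_idealN. Qed.

Lemma ideal_sum J (T : Type) (r : seq T) (P : pred T) (F : T -> A) :
  is_ideal J -> (forall i, P i -> J (F i)) -> J (\sum_(i <- r | P i) F i).
Proof.
move=> iJ JF; apply: (big_ind J) => //; first exact: is_ideal0.
by move=> a b; apply: is_idealD.
Qed.

Lemma ideal_gen_mem S a : S a -> ideal_gen S a.
Proof. by move=> Sa J [_]; apply. Qed.

Lemma ideal_gen_sub S J : is_ideal J -> S `<=` J -> ideal_gen S `<=` J.
Proof. by move=> iJ SJ a; apply. Qed.

Lemma is_ideal_mul I J : is_ideal (ideal_mul I J).
Proof. exact: is_ideal_gen. Qed.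

Lemma ideal_mul_mem I J a b : I a -> J b -> ideal_mul I J (a * b).
Proof. by move=> Ia Jb; apply: ideal_gen_mem; exists a, b. Qed.

Lemma ideal_mul_sub I J K : is_ideal K ->
  (forall a b, I a -> J b -> K (a * b)) -> ideal_mul I J `<=` K.
Proof. by move=> iK H; apply: ideal_gen_sub => // _ [a [b [? ? ->]]]; apply: H. Qed.

Lemma ideal_mulS I I' J J' :
  I `<=` I' -> J `<=` J' -> ideal_mul I J `<=` ideal_mul I' J'.
Proof.
move=> sI sJ; apply: ideal_mul_sub; first exact: is_ideal_mul.
by move=> a b /sI ? /sJ ?; apply: ideal_mul_mem.
Qed.

Lemma ideal_mul_subr I J : is_ideal J -> ideal_mul I J `<=` J.
Proof. by move=> iJ; apply: ideal_mul_sub => // a b _; apply: is_idealMl. Qed.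

Lemma is_ideal_preim I x : is_ideal I -> is_ideal [set z | I (x * z)].
Proof.
move=> iI; split=> [|a b|r a] /=; first by rewrite mulr0; apply: is_ideal0.
  by rewrite mulrDr; apply: is_idealD.
by rewrite mulrCA; apply: is_idealMl.
Qed.

(** Lets inductions on products absorb a further element of [I] into the power while the factor from
    [J] is kept. *)
Lemma ideal_mul_expS I J n x z : I x ->
  ideal_mul J (ideal_exp I n) z -> ideal_mul J (ideal_exp I n.+1) (x * z).
Proof.
move=> Ix; pose K := [set z | ideal_mul J (ideal_exp I n.+1) (x * z)].
apply: (@ideal_mul_sub J (ideal_exp I n) K); first exact/is_ideal_preim/is_ideal_mul.
move=> a b Ja Ib; rewrite /K /= mulrCA; apply: ideal_mul_mem => //.
exact: ideal_mul_mem.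
Qed.

Definition ideal_add I J : set A := [set z | exists a b, [/\ I a, J b & z = a + b]].

Lemma is_ideal_add I J : is_ideal I -> is_ideal J -> is_ideal (ideal_add I J).
Proof.
move=> iI iJ; split.
- by exists 0, 0; rewrite addr0; split=> //; apply: is_ideal0.
- move=> _ _ [a [b [Ia Jb ->]]] [a' [b' [Ia' Jb' ->]]].
  by exists (a + a'), (b + b'); rewrite addrACA; split=> //; apply: is_idealD.
- move=> r _ [a [b [Ia Jb ->]]]; exists (r * a), (r * b).
  by rewrite mulrDr; split=> //; apply: is_idealMl.
Qed.

Lemma ideal_addl I J a : is_ideal J -> I a -> ideal_add I J a.
Proof. by move=> iJ Ia; exists a, 0; rewrite addr0; split=> //; apply: is_ideal0. Qed.

Lemma ideal_addr I J a : is_ideal I -> J a -> ideal_add I J a.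
Proof. by move=> iI Ja; exists 0, a; rewrite add0r; split=> //; apply: is_ideal0. Qed.

Lemma ideal_add_sub I J K :
  is_ideal K -> I `<=` K -> J `<=` K -> ideal_add I J `<=` K.
Proof. by move=> iK IK JK _ [a [b [/IK ? /JK ? ->]]]; apply: is_idealD. Qed.

Definition span_seq s : set A := ideal_gen [set` s].

Lemma span_seq_cons x s :
  span_seq (x :: s) `<=` ideal_add [set r * x | r in setT] (span_seq s).
Proof.
have ix : is_ideal [set r * x | r in setT].
  split; first by exists 0; rewrite ?mul0r.
    by move=> _ _ [a _ <-] [b _ <-]; exists (a + b); rewrite ?mulrDl.
  by move=> r _ [a _ <-]; exists (r * a); rewrite ?mulrA.
apply: ideal_gen_sub; first by apply: is_ideal_add => //; apply: is_ideal_gen.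
move=> y /=; rewrite inE => /orP[/eqP ->|ys].
  by apply: ideal_addl; [apply: is_ideal_gen | exists 1; rewrite ?mul1r].
by apply: ideal_addr => //; apply: ideal_gen_mem.
Qed.

(** Induction on [s]: the relation for its head [x] has a coefficient [c] in [m] on [x] itself, and
    inverting [1 - c] eliminates [x] from the remaining relations. *)
Lemma nakayama (m J : set A) s : is_ideal m -> is_ideal J ->
    (forall c, m c -> exists b, (1 - c) * b = 1) ->
    (forall x, x \in s -> ideal_add J (ideal_mul m (span_seq s)) x) ->
  forall x, x \in s -> J x.
Proof.
move=> im + mU; elim: s J => [|x s IHs] J iJ //= H.
have iS : is_ideal (span_seq s) by apply: is_ideal_gen.
pose N := ideal_add J (ideal_mul m (span_seq s)).
have iN : is_ideal N by apply: is_ideal_add => //; apply: is_ideal_mul.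
have dec y : ideal_add J (ideal_mul m (span_seq (x :: s))) y ->
    exists2 c, m c & N (y - c * x).
  case=> a [b [Ja mb ->]].
  suff [c mc mbc] : exists2 c, m c & ideal_mul m (span_seq s) (b - c * x).
    by exists c => //; exists a, (b - c * x); rewrite addrA.
  pose K := [set b | exists2 c, m c & ideal_mul m (span_seq s) (b - c * x)].
  apply: (@ideal_mul_sub m (span_seq (x :: s)) K) mb.
    split.
    - by exists 0; rewrite ?mul0r ?subr0; apply: is_ideal0 => //; apply: is_ideal_mul.
    - move=> {}b b' [c mc Hc] [c' mc' Hc']; exists (c + c'); first exact: is_idealD.
      have -> : b + b' - (c + c') * x = (b - c * x) + (b' - c' * x) by ring.
      exact: is_idealD (is_ideal_mul _ _) _ _.
    - move=> r {}b [c mc Hc]; exists (r * c); first exact: is_idealMl.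
      by rewrite -mulrA -mulrBr; apply: is_idealMl (is_ideal_mul _ _) _.
  move=> u v mu /span_seq_cons[_ [w [[r _ <-] sw ->]]].
  exists (u * r); first exact: is_idealMr.
  have -> : u * (r * x + w) - u * r * x = u * w by ring.
  exact: ideal_mul_mem.
have Nx : N x.
  have [c mc Hc] := dec _ (H x (mem_head _ _)).
  have [b cb] := mU c mc.
  have -> : x = b * (x - c * x).
    by rewrite -{1}[x]mulr1 -cb; ring.
  exact: is_idealMl.
have Hs y : y \in s -> J y.
  apply: IHs => // {}y ys; have [|c mc Hc] := dec y; first by apply: H; rewrite inE ys orbT.
  by rewrite -[y](subrK (c * x)); apply: is_idealD => //; apply: is_idealMl.
have NJ : N `<=` J.
  apply: ideal_add_sub => // y my; apply: (ideal_gen_sub iJ _).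
    exact: Hs.
  exact: ideal_mul_subr my.
by move=> y; rewrite inE => /orP[/eqP ->|/Hs //]; apply: NJ.
Qed.

End IdealTheory.

(** * Orders of vanishing at the origin *)

Section OrderFiltration.
Variables (k : fieldType) (n : nat).
Implicit Types (f g : {mpoly k[n]}) (z : localPoly k n).

Definition order_ge N f := forall m, (mdeg m < N)%N -> f@_m = 0.

Lemma order_geD N f g : order_ge N f -> order_ge N g -> order_ge N (f + g).
Proof. by move=> fN gN m mN; rewrite mcoeffD fN // gN // addr0. Qed.

Lemma order_geM M N f g : order_ge M f -> order_ge N g -> order_ge (M + N) (f * g).
Proof.
move=> fM gN m mMN; rewrite mcoeffM big1 // => -[m1 m2] /= /eqP mE.
have [/fM -> |m1M] := ltnP (mdeg m1) M; first by rewrite mul0r.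
rewrite gN ?mulr0 //; move/(congr1 (@mdeg n)): mE; rewrite mdegD; lia.
Qed.

Lemma order_ge_homog N f : f \is N.-homog -> order_ge N f.
Proof. by move=> hf m mN; apply: (dhomog_nemf_coeff hf); rewrite neq_ltn mN. Qed.

(** This is the [N]-th power of the maximal ideal, in a form that makes membership a matter of
    coefficients of a numerator. *)
Definition order_ideal N : set (localPoly k n) := [set z | exists f g,
  [/\ g@_0%MM != 0, z * toLocal g = toLocal f & order_ge N f]].

Definition const_local (c : k) : localPoly k n := toLocal c%:MP.

Lemma const_local_is_zmod_morphism : zmod_morphism const_local.
Proof. by move=> a b; rewrite /const_local mpolyCB rmorphB. Qed.

Lemma const_local_is_monoid_morphism : monoid_morphism const_local.
Proof. by split=> [|a b]; rewrite /const_local ?mpolyC1 ?rmorph1 // mpolyCM rmorphM. Qed.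

HB.instance Definition _ :=
  GRing.isZmodMorphism.Build k (localPoly k n) const_local const_local_is_zmod_morphism.
HB.instance Definition _ :=
  GRing.isMonoidMorphism.Build k (localPoly k n) const_local const_local_is_monoid_morphism.

Lemma toLocal_inj : injective (@toLocal k n).
Proof. by move=> f g /(congr1 val) /= /eqP; rewrite tofrac_eq => /eqP. Qed.

Lemma mcoeff0M f g : (f * g)@_0%MM = f@_0%MM * g@_0%MM.
Proof. exact: rmorphM (mcoeff 0%MM) _ _. Qed.

Lemma localPolyP z : exists f g, g@_0%MM != 0 /\ z * toLocal g = toLocal f.
Proof.
case: z => z zl; have /asboolP[f [g [g0 zE]]] := zl; exists f, g; split.
  by apply/eqP => g00; apply: g0; rewrite origin_idealE.
by apply: val_inj; rewrite /= zE divfK // notin_origin_neq0.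
Qed.

Lemma is_ideal_order N : is_ideal (order_ideal N).
Proof.
split.
- exists 0, 1; rewrite mcoeff1 eqxx oner_eq0 mul0r rmorph0; split=> // m _.
  by rewrite mcoeff0.
- move=> z z' [f [g [g0 zE fN]]] [f' [g' [g'0 z'E f'N]]].
  exists (f * g' + f' * g), (g * g'); split.
  + by rewrite mcoeff0M mulf_neq0.
  + by rewrite rmorphD !rmorphM /= -zE -z'E mulrDl mulrA [toLocal g * _]mulrC mulrA.
  + by apply: order_geD; rewrite -[N]addn0; apply: order_geM.
- move=> r z [f [g [g0 zE fN]]]; have [f' [g' [g'0 rE]]] := localPolyP r.
  exists (f' * f), (g' * g); split.
  + by rewrite mcoeff0M mulf_neq0.
  + by rewrite !rmorphM /= -zE -rE mulrACA.
  + by rewrite -[N]add0n; apply: order_geM.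
Qed.

Lemma order_idealM M N z z' : order_ideal M z -> order_ideal N z' ->
  order_ideal (M + N) (z * z').
Proof.
move=> [f [g [g0 zE fN]]] [f' [g' [g'0 z'E f'N]]].
exists (f * f'), (g * g'); split.
- by rewrite mcoeff0M mulf_neq0.
- by rewrite !rmorphM /= -zE -z'E mulrACA.
- exact: order_geM.
Qed.

Lemma order_ideal_toLocal N f : f \is N.-homog -> order_ideal N (toLocal f).
Proof.
move=> hf; exists f, 1; rewrite mcoeff1 eqxx oner_eq0 rmorph1 mulr1.
by split=> //; apply: order_ge_homog.
Qed.

(** If [g] does not vanish at the origin, the part of degree [N] of [f * g] is a nonzero multiple of
    [f]. *)
Lemma order_ideal_homog_eq0 N f : f \is N.-homog ->
  order_ideal N.+1 (toLocal f) -> f = 0.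
Proof.
move=> hf [f' [g [g0 + f'N]]]; rewrite -rmorphM => /toLocal_inj fg.
apply/mpolyP => m; rewrite mcoeff0.
have [mN|/(dhomog_nemf_coeff hf) //] := eqVneq (mdeg m) N.
have g1 : order_ge 1 (g - (g@_0%MM)%:MP).
  move=> m'; rewrite ltnS leqn0 mdeg_eq0 => /eqP ->.
  by rewrite mcoeffB mcoeffC eqxx mulr1 subrr.
have fgE : f * g = f * (g - (g@_0%MM)%:MP) + g@_0%MM *: f.
  by rewrite -mul_mpolyC; ring.
move/(congr1 (mcoeff m)): fgE; rewrite fg f'N ?mN // mcoeffD mcoeffZ.
rewrite (order_geM (order_ge_homog hf) g1) ?mN ?addn1 // add0r => /esym/eqP.
by rewrite mulf_eq0 (negPf g0) => /eqP.
Qed.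

Lemma order_ideal1_maximal : order_ideal 1 `<=` maximal_ideal k n.
Proof.
move=> z [f [g [g0 zE f1]]]; rewrite maximal_idealE => -[b zb].
have [f' [g' [g'0 bE]]] := localPolyP b.
have fE : f * f' = g * g'.
  by apply: toLocal_inj; rewrite !rmorphM /= -zE -bE mulrACA zb mul1r.
by move/eqP: (mulf_neq0 g0 g'0); rewrite -mcoeff0M -fE mcoeff0M f1 ?mdeg0 // mul0r.
Qed.

Lemma maximal_order_ideal1 : maximal_ideal k n `<=` order_ideal 1.
Proof.
apply: ideal_gen_sub; first exact: is_ideal_order.
by move=> _ [i _ <-]; apply: order_ideal_toLocal; rewrite dhomogX /= mdeg1.
Qed.

Lemma residue z : exists c, maximal_ideal k n (z - const_local c).
Proof.
have [f [g [g0 zE]]] := localPolyP z; exists (f@_0%MM / g@_0%MM).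
apply: order_ideal1_maximal; exists (f - (f@_0%MM / g@_0%MM) *: g), g; split=> //.
  by rewrite mulrBl zE /const_local -rmorphM mul_mpolyC -rmorphB.
move=> m; rewrite ltnS leqn0 mdeg_eq0 => /eqP ->.
by rewrite mcoeffB mcoeffZ divfK // subrr.
Qed.

Lemma is_ideal_maximal : is_ideal (maximal_ideal k n).
Proof. exact: is_ideal_gen. Qed.

Lemma maximal_subr1_unit (c : localPoly k n) :
  maximal_ideal k n c -> exists b, (1 - c) * b = 1.
Proof.
move=> mc; apply: contrapT => nu.
have /(is_idealD is_ideal_maximal mc) : maximal_ideal k n (1 - c) by rewrite maximal_idealE.
by rewrite addrC subrK maximal_idealE; apply; exists 1; rewrite mulr1.
Qed.

End OrderFiltration.

Arguments order_ideal {k n} N.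
Arguments is_ideal_order {k n} N.

(** * The toric ideal of an even cycle *)

Section EvenCycle.
Variables (D : nat) (D_gt0 : (0 < D)%N).
Local Notation d := D.*2.

Fact cyc_subproof n : (n %% d < d)%N.
Proof. by rewrite ltn_pmod // double_gt0. Qed.

Definition cyc n : 'I_d := Ordinal (cyc_subproof n).

Lemma cyc_val (i : 'I_d) : cyc i = i.
Proof. by apply: val_inj; rewrite /= modn_small. Qed.

Lemma ordS_cyc n : ordS (cyc n) = cyc n.+1.
Proof. by apply: val_inj; rewrite /= -addn1 modnDml addn1. Qed.

Lemma cycDd n : cyc (n + d) = cyc n.
Proof. by apply: val_inj; rewrite /= modnDr. Qed.

(** * Alternating products around the cycle *)

Section AltProd.
Variable A : comNzRingType.
Implicit Types p q : 'I_d -> A.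

(** Only the parity of [l] matters, but an arbitrary starting index suits walks around the cycle. *)
Definition altprod p l := \prod_(s < D) p (cyc (l + s.*2)).

(** The last factor on the left has index [l + d], which wraps around to the first factor on the
    right. *)
Lemma altprodSS p l : altprod p l.+2 = altprod p l.
Proof.
rewrite /altprod; move: cycDd; case: D D_gt0 p cyc => // E _ p c cE.
rewrite big_ord_recr big_ord_recl /= addn0 mulrC; congr (_ * _).
  by rewrite -(cE l) doubleS !addSn !addnS.
by apply: eq_bigr => s _; congr (p (c _)); rewrite /bump /=; lia.
Qed.

Lemma altprodM p q l : altprod (fun i => p i * q i) l = altprod p l * altprod q l.
Proof. exact: big_split. Qed.

Lemma altprod_ordS p l : altprod (fun i => p (ordS i)) l = altprod p l.+1.
Proof. by apply: eq_bigr => s _; rewrite ordS_cyc. Qed.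

Lemma altprodX p c l : altprod (fun i => p i ^+ c) l = altprod p l ^+ c.
Proof. exact: prodrXl. Qed.

Lemma prod_altprod p : \prod_i p i = altprod p 0 * altprod p 1.
Proof.
have H (F : nat -> A) E : \prod_(i < E.*2) F i =
    (\prod_(s < E) F s.*2) * \prod_(s < E) F s.*2.+1.
  elim: E => [|E IH]; first by rewrite !big_ord0 mulr1.
  by rewrite doubleS !big_ord_recr /= IH; ring.
rewrite /altprod -(H (fun n => p (cyc n))).
by apply: eq_bigr => i _; rewrite cyc_val.
Qed.

(** The edges of either parity cover every vertex once, so both sides are the product of all
    [p i]. *)
Lemma altprod_edges p :
  altprod (fun i => p i * p (ordS i)) 0 = altprod (fun i => p i * p (ordS i)) 1.
Proof. by rewrite !altprodM !altprod_ordS altprodSS mulrC. Qed.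

Lemma altprod_neqS p : altprod p 0 <> altprod p 1 ->
  forall l, altprod p l <> altprod p l.+1.
Proof.
move=> ne; elim/ltn_ind => -[|[|l]] IH //; first by rewrite altprodSS => /esym.
by rewrite !altprodSS; apply: IH.
Qed.

(* Exponent vectors with equal sums on consecutive indices differ by an
   alternating constant, because the cycle is even. *)
Lemma prod_exp_congr (H : set A) p (u v : 'I_d -> nat) : is_ideal H ->
    H (altprod p 0 - altprod p 1) ->
    (forall i, u (ordS i) + u i = v (ordS i) + v i)%N ->
  H (\prod_i p i ^+ u i - \prod_i p i ^+ v i).
Proof.
move=> iH Hp; wlog le_vu : u v / (v (cyc 0) <= u (cyc 0))%N => [wl uv|uv].
  have [/wl|/ltnW/wl] := leqP (v (cyc 0)) (u (cyc 0)); first exact.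
  by move=> /(_ (fun i => esym (uv i))) /(is_idealN iH); rewrite opprB.
pose c := (u (cyc 0) - v (cyc 0))%N.
have alt s : (u (cyc s.*2) = v (cyc s.*2) + c /\
              v (cyc s.*2.+1) = u (cyc s.*2.+1) + c)%N.
  have odd t : (u (cyc t) = v (cyc t) + c -> v (cyc t.+1) = u (cyc t.+1) + c)%N.
    by have := uv (cyc t); rewrite ordS_cyc; lia.
  elim: s => [|s [_ vE]]; first by split; [|apply: odd]; rewrite double0 subnKC.
  have uE : (u (cyc s.+1.*2) = v (cyc s.+1.*2) + c)%N.
    by have := uv (cyc s.*2.+1); rewrite ordS_cyc doubleS; lia.
  by split=> //; apply: odd.
rewrite !prod_altprod.
have -> : altprod (fun i => p i ^+ u i) 0 =
    altprod (fun i => p i ^+ v i) 0 * altprod p 0 ^+ c.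
  rewrite -altprodX -altprodM; apply: eq_bigr => s _.
  by rewrite add0n (alt s).1 exprD.
have -> : altprod (fun i => p i ^+ v i) 1 =
    altprod (fun i => p i ^+ u i) 1 * altprod p 1 ^+ c.
  rewrite -altprodX -altprodM; apply: eq_bigr => s _.
  by rewrite add1n (alt s).2 exprD.
set a := altprod _ 0; set b := altprod _ 1.
(* The common factor comes out, and the difference of the two products divides the difference of
   their powers. *)
have -> : a * altprod p 0 ^+ c * b - a * (b * altprod p 1 ^+ c) =
  a * b * (altprod p 0 ^+ c - altprod p 1 ^+ c) by ring.
by rewrite subrXX; apply: (is_idealMl _ iH); apply: is_idealMr.
Qed.

End AltProd.

Variable k : fieldType.
Implicit Types (G : {mpoly k[d]}) (u v m : 'X_{1..d}).

Definition edge (i : 'I_d) : {mpoly k[d]} := 'X_i * 'X_(ordS i).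

Definition edge_mon u : 'X_{1..d} := (\sum_i (U_(i) + U_(ordS i)) *+ u i)%MM.

Lemma mmap1_edge u : mmap1 edge u = 'X_[edge_mon u].
Proof.
by rewrite -mprodXnE; apply: eq_bigr => i _; rewrite /edge mpolyXD.
Qed.

(** The vertex [ordS i] lies exactly on the edges [i] and [ordS i]. *)
Lemma edge_mon_ordS u i : edge_mon u (ordS i) = (u (ordS i) + u i)%N.
Proof.
rewrite mnm_sumE (eq_bigr (fun j => (j == ordS i) * u j + (j == i) * u j)%N).
  rewrite big_split /= (bigD1 (ordS i)) //= eqxx mul1n big1 ?addn0.
    rewrite (bigD1 i) //= eqxx mul1n big1 ?addn0 //.
    by move=> j /negPf ->.
  by move=> j /negPf ->.
by move=> j _; rewrite mulmnE mnmDE !mnm1E (inj_eq (@ordS_inj _)) mulnDl.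
Qed.

Lemma mdeg_edge_mon u : mdeg (edge_mon u) = (mdeg u).*2.
Proof.
rewrite /edge_mon mdeg_sum mdegE -[RHS]muln2 big_distrl; apply: eq_bigr => i _.
by rewrite mdegMn mdegD !mdeg1 mulnC.
Qed.

(** Its kernel is the toric ideal of the cycle, and its source modulo this kernel is the fiber ring
    of the edge ideal. *)
Definition edge_map : {mpoly k[d]} -> {mpoly k[d]} := mmap (@mpolyC d k) edge.

HB.instance Definition _ := 
  GRing.RMorphism.copy edge_map (mmap (@mpolyC d k) edge).

Lemma edge_mapE G : edge_map G = \sum_(u <- msupp G) G@_u *: 'X_[edge_mon u].
Proof. by apply: eq_bigr => u _; rewrite mul_mpolyC mmap1_edge. Qed.

Lemma edge_mapC c : edge_map c%:MP = c%:MP.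
Proof. exact: mmapC. Qed.

Lemma edge_mapX i : edge_map 'X_i = edge i.
Proof. by rewrite /edge_map mmapX mmap1U. Qed.

Lemma edge_map_homog r G : G \is r.-homog -> edge_map G \is (r.*2).-homog.
Proof.
move=> /dhomogP hG; rewrite edge_mapE big_seq; apply: rpred_sum => u uG.
by apply: rpredZ; rewrite dhomogX /= mdeg_edge_mon hG.
Qed.

(* The toric ideal of the even cycle is generated by the difference of the two
   alternating products of the variables. *)
Lemma edge_map_ker (A : comNzRingType) (f : {rmorphism k -> A}) (p : 'I_d -> A)
    (H : set A) G : is_ideal H -> H (altprod p 0 - altprod p 1) ->
  edge_map G = 0 -> H (mmap f p G).
Proof.
move=> iH Hp G0.
pose w m := mmap1 p (xget 0%MM [set u | edge_mon u = m]).
have Hw u : H (mmap1 p u - w (edge_mon u)).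
  apply: prod_exp_congr => // i; rewrite -!edge_mon_ordS.
  have uE : [set u' | edge_mon u' = edge_mon u] u by [].
  by rewrite [in RHS](xgetI 0%MM uE).
(* With [w] the sum can be grouped by monomials, and each group is weighted by a coefficient of
   [edge_map G], hence by zero. *)
suff wG0 : \sum_(u <- msupp G) f G@_u * w (edge_mon u) = 0.
  rewrite -[mmap f p G]subr0 -wG0 /mmap -sumrB; apply: ideal_sum => // u _.
  by rewrite -mulrBr; apply: is_idealMl.
pose S := undup (map edge_mon (msupp G)).
have coefS m : \sum_(u <- msupp G) f G@_u * (edge_mon u == m)%:R = 0.
  have := congr1 (fun F => f F@_m) G0; rewrite /= mcoeff0 rmorph0.
  rewrite edge_mapE (raddf_sum (mcoeff m)) rmorph_sum /=; apply: etrans.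
  by apply: eq_bigr => u _; rewrite mcoeffZ mcoeffX rmorphM rmorph_nat.
transitivity (\sum_(m <- S) (\sum_(u <- msupp G) f G@_u * (edge_mon u == m)%:R) * w m).
  under [RHS]eq_bigr do rewrite mulr_suml.
  rewrite exchange_big /=; apply: eq_big_seq => u uG.
  rewrite (bigD1_seq (edge_mon u)) ?undup_uniq ?mem_undup ?map_f //= eqxx mulr1.
  by rewrite big1 ?addr0 // => m; rewrite eq_sym => /negPf ->; rewrite mulr0 mul0r.
by rewrite big1 // => m _; rewrite coefS mul0r.
Qed.

End EvenCycle.

(** * Initial forms *)

Section Approximation.
Variables (D : nat) (D_gt0 : (0 < D)%N) (k : fieldType).
Local Notation d := D.*2.
Local Notation I := (cycle_edge_ideal k d).
Local Notation M := (maximal_ideal k d).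
Local Notation ledge i := (toLocal (edge k i)).
Implicit Types (G : {mpoly k[d]}) (z : localPoly k d) (v : 'rV[k]_d).

Lemma ledge_in (i : 'I_d) : I (ledge i).
Proof. by apply: ideal_gen_mem; exists i. Qed.

Lemma is_ideal_edge : is_ideal I.
Proof. exact: is_ideal_gen. Qed.

Lemma edge_homog (i : 'I_d) : edge k i \is 2.-homog.
Proof. by rewrite /edge -mpolyXD dhomogX /= mdegD !mdeg1. Qed.

Lemma max_edge_order : ideal_mul M I `<=` order_ideal 3.
Proof.
apply: ideal_mul_sub; first exact: is_ideal_order.
move=> a b /maximal_order_ideal1 a1 Ib; apply: (order_idealM (M := 1) (N := 2)) => //.
move: b Ib; apply: ideal_gen_sub; first exact: is_ideal_order.
by move=> _ [i _ <-]; apply/order_ideal_toLocal/edge_homog.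
Qed.

(** * Values of initial forms at a point *)

Section Evaluation.
Variables (A : comNzRingType) (f : {rmorphism k -> A}) (p : 'I_d -> A).
Implicit Type H : set A.

(* The elements whose initial form of degree 2r is a degree r form in the edges
   taking a value in H at p. *)
Definition approx H r : set (localPoly k d) := [set z | exists G,
  [/\ G \is r.-homog, H (mmap f p G) &
      order_ideal r.*2.+1 (z - toLocal (edge_map G))]].

Lemma approx_order H r : approx H r `<=` order_ideal r.*2.
Proof.
move=> z [G [hG _ /[dup] zG _]]; rewrite -[z](subrK (toLocal (edge_map G))).
apply: is_idealD; first exact: is_ideal_order.
  case: zG => g [h [h0 hE gE]]; exists g, h; split=> // m mr; apply: gE.
  exact: leq_trans mr _.
exact/order_ideal_toLocal/edge_map_homog.
Qed.

Lemma is_ideal_approx H r : is_ideal H -> is_ideal (approx H r).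
Proof.
move=> iH; have iO := @is_ideal_order k d r.*2.+1; split.
- exists 0; split; rewrite ?rpred0 ?mmap0 //; first exact: is_ideal0.
  by rewrite !rmorph0 subr0; apply: is_ideal0.
- move=> z z' [G [hG HG Gz]] [G' [hG' HG' Gz']]; exists (G + G').
  split; first exact: rpredD.
    by rewrite mmapD; apply: is_idealD.
  by rewrite !rmorphD opprD addrACA; apply: is_idealD.
- move=> a z az; have zO := approx_order az; case: az => G [hG HG Gz].
  (* Up to higher order, [a] acts on initial forms through its residue [c]. *)
  have [c /maximal_order_ideal1 ac] := residue a.
  exists (c *: G); split; first exact: rpredZ.
    by rewrite mmapZ; apply: is_idealMl.
  have -> : a * z - toLocal (edge_map (c *: G)) =
      (a - const_local d c) * z + const_local d c * (z - toLocal (edge_map G)).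
    by rewrite -mul_mpolyC !rmorphM /= edge_mapC mulrBl mulrBr addrA subrK.
  apply: is_idealD => //; last exact: is_idealMl.
  exact: (order_idealM (M := 1)).
Qed.

Lemma approxM H r s z z' : is_ideal H -> approx H r z -> approx setT s z' ->
  approx H (r + s) (z * z').
Proof.
move=> iH [G [hG HG Gz]] z's; have z'O := approx_order z's.
case: z's => G' [hG' _ Gz']; exists (G * G'); split; first exact: dhomogM.
  by rewrite rmorphM; apply: is_idealMr.
have -> : z * z' - toLocal (edge_map (G * G')) =
    (z - toLocal (edge_map G)) * z' + toLocal (edge_map G) * (z' - toLocal (edge_map G')).
  by rewrite !rmorphM /= mulrBl mulrBr addrA subrK.
rewrite doubleD; apply: is_idealD; first exact: is_ideal_order.
  by rewrite -addSn; apply: order_idealM.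
rewrite -addnS; apply: order_idealM => //.
exact/order_ideal_toLocal/edge_map_homog.
Qed.

Lemma approx_edge_map H r G : G \is r.-homog -> H (mmap f p G) ->
  approx H r (toLocal (edge_map G)).
Proof.
by move=> hG HG; exists G; rewrite subrr; split=> //; apply: is_ideal0 (is_ideal_order _).
Qed.

(** An initial form determines its expression in the edges only up to the toric ideal, whose values
    at [p] lie in [H]. *)
Lemma approx_edge_mapP H r G : is_ideal H -> H (altprod D_gt0 p 0 - altprod D_gt0 p 1) ->
  G \is r.-homog -> approx H r (toLocal (edge_map G)) -> H (mmap f p G).
Proof.
move=> iH Hp hG [G' [hG' HG']]; rewrite -!rmorphB => GG'.
rewrite -[G](subrK G') mmapD; apply: is_idealD => //.
apply: (edge_map_ker _ iH Hp); apply: (order_ideal_homog_eq0 _ GG').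
exact/edge_map_homog/rpredB.
Qed.

Lemma edge_ideal_exp_approx r : ideal_exp I r `<=` approx setT r.
Proof.
have iT : is_ideal (@setT A) by [].
elim: r => [z _|r IH].
  have [c /maximal_order_ideal1 zc] := residue z.
  exists c%:MP; split; rewrite ?edge_mapC //.
  by rewrite -[c%:MP]mulr1 mul_mpolyC; apply: rpredZ; apply: dhomog1.
apply: ideal_mul_sub; first exact: is_ideal_approx.
move=> a b Ia /IH Tb; apply: (approxM (r := 1) iT _ Tb).
move: a Ia; apply: ideal_gen_sub; first exact: is_ideal_approx.
move=> _ [i _ <-]; rewrite -/(edge k i) -edge_mapX.
by apply: approx_edge_map; rewrite // dhomogX /= mdeg1.
Qed.

(** The power [r.+1] of the edge [a] lies in [J I^r], so its initial form takes a value in [H] at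
    [p]. Taking for [H] the zero ideal treats points over [k], and a principal ideal of polynomials
    treats points over an extension. *)
Lemma reduction_eval (J : set (localPoly k d)) H r a : is_ideal H ->
    H (altprod D_gt0 p 0 - altprod D_gt0 p 1) ->
    ideal_exp I r.+1 = ideal_mul J (ideal_exp I r) ->
    J `<=` approx H 1 -> H (p a ^+ r.+1).
Proof.
move=> iH Hp IJ JH.
have aI s : ideal_exp I s (ledge a ^+ s).
  by elim: s => [|s IHs] //; rewrite exprS; apply: ideal_mul_mem => //; apply: ledge_in.
have : approx H r.+1 (ledge a ^+ r.+1).
  move: (aI r.+1); rewrite IJ; apply: ideal_mul_sub; first exact: is_ideal_approx.
  by move=> x y /JH Hx /edge_ideal_exp_approx; apply: (approxM (r := 1)).
rewrite -edge_mapX -!rmorphXn => /(approx_edge_mapP iH Hp).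
rewrite rmorphXn /= mmapX mmap1U; apply.
have X1 : 'X_a \is [in k[d], 1.-homog] by rewrite dhomogX /= mdeg1.
by have := dhomogMn r.+1 X1; rewrite mul1n.
Qed.

End Evaluation.

Definition lin v : {mpoly k[d]} := \sum_i v 0 i *: 'X_i.
Definition comb v : localPoly k d := toLocal (edge_map (lin v)).

Lemma lin_homog v : lin v \is 1.-homog.
Proof. by apply: rpred_sum => i _; apply: rpredZ; rewrite dhomogX /= mdeg1. Qed.

Lemma mmap_lin (A : comNzRingType) (f : {rmorphism k -> A}) p v :
  mmap f p (lin v) = \sum_i f (v 0 i) * p i.
Proof. by rewrite raddf_sum; apply: eq_bigr => i _; rewrite /= mmapZ mmapX mmap1U. Qed.

Lemma combE v : comb v = \sum_i const_local d (v 0 i) * ledge i.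
Proof.
rewrite /comb {1}/edge_map mmap_lin rmorph_sum; apply: eq_bigr => i _.
by rewrite rmorphM.
Qed.

Lemma combD v w : comb (v + w) = comb v + comb w.
Proof.
by rewrite !combE -big_split; apply: eq_bigr => i _; rewrite mxE rmorphD mulrDl.
Qed.

Lemma combZ c v : comb (c *: v) = const_local d c * comb v.
Proof.
by rewrite !combE mulr_sumr; apply: eq_bigr => i _; rewrite mxE rmorphM mulrA.
Qed.

Lemma comb_delta (i : 'I_d) : comb (delta_mx 0 i) = ledge i.
Proof.
rewrite combE (bigD1 i) //= mxE !eqxx rmorph1 mul1r big1 ?addr0 // => j /negPf ji.
by rewrite mxE ji andbF rmorph0 mul0r.
Qed.

Lemma comb_in v : I (comb v).
Proof.
rewrite combE; apply: ideal_sum => [|i _]; first exact: is_ideal_edge.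
by apply: (is_idealMl _ is_ideal_edge); apply: ledge_in.
Qed.

(** Modulo [M I], coefficients in the local ring may be replaced by their residues. *)
Lemma edge_ideal_comb z : I z -> exists v, ideal_mul M I (z - comb v).
Proof.
have iMI := is_ideal_mul M I.
pose K := [set z | exists v, ideal_mul M I (z - comb v)].
apply: (ideal_gen_sub (J := K)).
  split.
  - exists 0; rewrite combE big1 ?subr0; first exact: is_ideal0 iMI.
    by move=> i _; rewrite mxE rmorph0 mul0r.
  - move=> a b [v va] [w wb]; exists (v + w).
    by rewrite combD opprD addrACA; apply: (is_idealD iMI).
  - move=> r a [v va]; have [c rc] := residue r; exists (c *: v).
    have -> : r * a - comb (c *: v) = r * (a - comb v) + (r - const_local d c) * comb v.
      by rewrite combZ mulrBr mulrBl addrA subrK.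
    by apply: (is_idealD iMI); [apply: (is_idealMl _ iMI) | apply: ideal_mul_mem (comb_in v)].
move=> _ [i _ <-]; exists (delta_mx 0 i); rewrite comb_delta subrr.
exact: is_ideal0 iMI.
Qed.

End Approximation.

(** * The points attached to a reduction *)

Section Annihilators.
Variables (k : fieldType) (n : nat).
Implicit Types (V : set 'rV[k]_n) (v : 'rV[k]_n) (p q : 'I_n -> k).

Definition dot v p := \sum_i v 0 i * p i.

Definition is_subspace V :=
  [/\ V 0, forall v w, V v -> V w -> V (v + w) & forall c v, V v -> V (c *: v)].

(** Among the matrices with rows in [V], one of maximal rank spans [V], since adding a vector of [V]
    to its rows cannot raise the rank. *)
Lemma subspace_rowspace V : is_subspace V ->
  exists B : 'M[k]_n, forall v, V v <-> (v <= B)%MS.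
Proof.
move=> [V0 VD VZ].
have Vmul m (B : 'M[k]_(m, n)) (u : 'rV_m) : (forall i, V (row i B)) -> V (u *m B).
  by move=> VB; rewrite mulmx_sum_row; apply: (big_ind V) => // i _; apply: VZ.
pose P r := `[< exists B : 'M[k]_n, (forall i, V (row i B)) /\ \rank B = r >].
have exP : exists r, P r.
  by exists 0%N; apply/asboolP; exists 0; rewrite mxrank0; split=> // i; rewrite row0.
have bP r : P r -> (r <= n)%N by move=> /asboolP[B [_ <-]]; apply: rank_leq_row.
case: (ex_maxnP exP bP) => r /asboolP[B [VB rB]] rmax; exists B => v; split=> [Vv|]; last first.
  by case/submxP => u ->; apply: Vmul.
have VBv i : V (row i (B + v)%MS).
  have /sub_addsmxP[[u w] /= ->] : (row i (B + v)%MS <= B + v)%MS by apply: row_sub.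
  apply: VD; first exact: Vmul.
  by rewrite [w]mx11_scalar mul_scalar_mx; apply: VZ.
have le : (\rank (B + v)%MS <= \rank B)%N.
  by rewrite rB; apply: rmax; apply/asboolP; exists (B + v)%MS.
apply: submx_trans (addsmxSr B v) _.
by rewrite -(mxrank_leqif_sup (addsmxSl B v)) eqn_leq le mxrankS ?addsmxSl.
Qed.

(** The cases are an orthogonal of dimension 0, 1 and at least 2. By the normalisation at [a], all
    points [q + t q'] have coordinate 1 there. *)
Lemma subspace_annihilator V : is_subspace V -> (forall v, V v) \/
  exists q a, [/\ q a = 1, forall v, V v -> dot v q = 0 &
    (forall v, dot v q = 0 -> V v) \/
    exists q' b, [/\ q' a = 0, q' b != 0 & forall v, V v -> dot v q' = 0]].
Proof.
move=> /subspace_rowspace[B BV]; pose C := cokermx B.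
have VC v : V v <-> v *m C = 0.
  by split=> [/BV|/eqP]; [rewrite submxE => /eqP | rewrite -submxE => /BV].
have dotC v j : dot v (fun i => C i j) = (v *m C) 0 j by rewrite mxE.
have [C0|/eqP C0] := eqVneq C 0; first by left=> v; apply/VC; rewrite C0 mulmx0.
right.
have [a [j Caj]] : exists a j, C a j != 0.
  apply: contrapT => H; apply: C0; apply/matrixP => a j; rewrite [RHS]mxE.
  by apply/eqP; apply: contrapT => /negP Caj; apply: H; exists a, j.
have dotq v : dot v (fun i => C i j / C a j) = (v *m C) 0 j / C a j.
  by rewrite -dotC mulr_suml; apply: eq_bigr => i _; rewrite mulrA.
exists (fun i => C i j / C a j), a; split; first by rewrite divff.
  by move=> v /VC vC; rewrite dotq vC [X in X / _]mxE mul0r.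
(* Either some column of [C], made zero at [a] by subtracting a multiple of the normalised column
   [j], is nonzero, or all columns are multiples of that one. *)
have [[j' [b Cb]]|H] := pselect (exists j' b, C b j' - C a j' * (C b j / C a j) != 0).
  right; exists (fun i => C i j' - C a j' * (C i j / C a j)), b; split=> //.
    by rewrite divff // mulr1 subrr.
  move=> v /VC vC; transitivity (dot v (fun i => C i j') -
      C a j' * dot v (fun i => C i j / C a j)).
    by rewrite mulr_sumr -sumrB; apply: eq_bigr => i _; rewrite mulrBr [in RHS]mulrCA.
  by rewrite dotq dotC vC [X in X - _]mxE [X in X / _]mxE mul0r mulr0 subr0.
left=> v vq; apply/VC/rowP => j'; rewrite -dotC [RHS]mxE.
transitivity (C a j' * dot v (fun i => C i j / C a j)); last by rewrite vq mulr0.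
rewrite mulr_sumr; apply: eq_bigr => i _; rewrite [RHS]mulrCA; congr (_ * _).
by apply/eqP; rewrite -subr_eq0; apply: contrapT => /negP Ci; apply: H; exists j', i.
Qed.

End Annihilators.

Lemma coef_prod_linear (R : comNzRingType) (c e : nat -> R) n :
  (\prod_(s < n) ((c s)%:P + e s *: 'X))`_n = \prod_(s < n) e s.
Proof.
(* The size bound kills the contribution of the constant term of the next factor. *)
suff [] : (size (\prod_(s < n) ((c s)%:P + e s *: 'X))%R <= n.+1)%N /\
  (\prod_(s < n) ((c s)%:P + e s *: 'X))`_n = \prod_(s < n) e s by [].
elim: n => [|n [sP cP]]; first by rewrite !big_ord0 size_poly1 coefC.
rewrite !big_ord_recr /=; set P := \prod_(i < n) _ in sP cP *; split.
  apply: leq_trans (size_polyMleq _ _) _.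
  have : (size ((c n)%:P + e n *: 'X)%R <= 2)%N.
    rewrite (leq_trans (size_polyD _ _)) // geq_max.
    by rewrite (leq_trans (size_polyC_leq1 _)) // (leq_trans (size_scale_leq _ _)) ?size_polyX.
  by lia.
rewrite mulrDr coefD coefMC -scalerAr coefZ coefMX /= cP.
by rewrite nth_default ?mul0r ?add0r // mulrC.
Qed.

(** * Good points obtained from reductions *)

Section GoodPoints.
Variables (D : nat) (D_gt0 : (0 < D)%N) (k : fieldType).
Local Notation d := D.*2.
Local Notation I := (cycle_edge_ideal k d).
Local Notation M := (maximal_ideal k d).
Local Notation Q := (altprod D_gt0).
Implicit Types (p q : 'I_d -> k) (J : set (localPoly k d)) (v : 'rV[k]_d).

(** One alternating product is 1 and the other has a zero factor; this supplies explicit good points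
    over any field. *)
Lemma altprod_neq_of_parity p (b : bool) (i0 : 'I_d) : (forall i : 'I_d, odd i = b -> p i = 1) ->
  odd i0 = ~~ b -> p i0 = 0 -> Q p 0 <> Q p 1.
Proof.
move=> p1 oi0 p0.
have oddc m : odd (cyc D_gt0 m) = odd m.
  by rewrite /= [in RHS](divn_eq m d) oddD oddM odd_double andbF.
have Qb : Q p b = 1.
  by rewrite /altprod big1 // => s _; apply: p1; rewrite oddc oddD odd_double addbF oddb.
have Qnb : Q p (~~ b) = 0.
  have hi : (i0./2 < D)%N by have := ltn_ord i0; lia.
  rewrite /altprod (bigD1 (Ordinal hi)) //= (_ : cyc _ _ = i0) ?p0 ?mul0r //.
  by rewrite -oi0 odd_double_half cyc_val.
by case: b Qb Qnb {p1 oi0} => /= -> -> /eqP; rewrite ?(eq_sym 0) oner_eq0.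
Qed.

(** For [J] inside [I] this records the image of [J] in [I] modulo [M I], in coordinates along the
    edges. *)
Definition initial_space J : set 'rV[k]_d :=
  [set v | exists2 z, J z & ideal_mul M I (z - comb v)].

Lemma is_subspace_initial J : is_ideal J -> is_subspace (initial_space J).
Proof.
move=> iJ; have iMI := is_ideal_mul M I; split.
- exists 0; first exact: is_ideal0.
  rewrite combE big1 ?subr0; first exact: is_ideal0 iMI.
  by move=> i _; rewrite mxE rmorph0 mul0r.
- move=> v w [y Jy yv] [z Jz zw]; exists (y + z); first exact: is_idealD.
  by rewrite combD opprD addrACA; apply: (is_idealD iMI).
- move=> c v [z Jz zv]; exists (const_local d c * z); first exact: is_idealMl.
  by rewrite combZ -mulrBr; apply: (is_idealMl _ iMI).
Qed.

Lemma initial_space_approx (A : comNzRingType) (f : {rmorphism k -> A})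
    (p : 'I_d -> A) (H : set A) J : J `<=` I ->
  (forall v, initial_space J v -> H (\sum_i f (v 0 i) * p i)) -> J `<=` approx f p H 1.
Proof.
move=> JI HJ z Jz; have [v zv] := edge_ideal_comb (JI z Jz).
exists (lin v); split; first exact: lin_homog.
  by rewrite mmap_lin; apply: HJ; exists z.
exact: max_edge_order.
Qed.

(** Otherwise [reduction_eval] with the zero ideal would make a power of the nonzero coordinate
    [q a] vanish. *)
Lemma reduction_altprod_neq J q a : is_reduction I J -> q a != 0 ->
  (forall v, initial_space J v -> dot v q = 0) -> Q q 0 <> Q q 1.
Proof.
move=> [iJ JI [r IJ]] qa Jq Qq.
have i0 : is_ideal [set (0 : k)].
  by split=> [|x y /= -> ->|x y /= ->]; rewrite ?addr0 ?mulr0.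
have /= : [set (0 : k)] (q a ^+ r.+1).
  apply: (reduction_eval (f := idfun) (D_gt0 := D_gt0) (J := J)) => //=.
    by rewrite Qq subrr.
  by apply: initial_space_approx => // v /Jq.
by apply/eqP; rewrite expf_eq0 /= (negPf qa).
Qed.

Lemma reduction_point J : is_reduction I J ->
  exists2 p, Q p 0 <> Q p 1 & forall v, dot v p = 0 -> initial_space J v.
Proof.
move=> redJ; have [iJ JI [r IJ]] := redJ.
case: (subspace_annihilator (is_subspace_initial iJ)) => [JT|[q [a [qa Jq]]]].
  (* Any good point will do here; the indicator of the even indices has alternating products 1 and
     0. *)
  exists (fun i => (odd i == false)%:R) => //.
  have d1 : (1 < d)%N by lia.
  apply: (@altprod_neq_of_parity _ false (Ordinal d1)) => // i ->.
  by rewrite eqxx.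
have qa0 : q a != 0 by rewrite qa oner_eq0.
case=> [qJ|[q' [b [q'a q'b Jq']]]].
  by exists q => //; apply: reduction_altprod_neq redJ qa0 Jq.
have Qq' := reduction_altprod_neq redJ q'b Jq'.
(* A common zero of the edge relation on the line through [q] and [q'], over an
   extension of [k], is the class of 'X in k['X] / (h). *)
pose p i := (q i)%:P + q' i *: 'X.
pose h := Q p 0 - Q p 1.
pose H := [set x : {poly k} | h %| x].
have iH : is_ideal H.
  by split=> [|x y|x y]; [apply: dvdp0 | apply: dvdp_add | apply: dvdp_mull].
have : H (p a ^+ r.+1).
  apply: (reduction_eval (f := polyC) (D_gt0 := D_gt0) (J := J)) => //=.
    exact: dvdpp.
  apply: initial_space_approx => // v Jv; rewrite /H /=.
  rewrite (_ : \sum_i _ = (dot v q)%:P + dot v q' *: 'X).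
    by rewrite Jq // Jq' // scale0r addr0 dvdp0.
  rewrite /dot rmorph_sum scaler_suml -big_split; apply: eq_bigr => i _.
  by rewrite /p /= mulrDr rmorphM /= !mul_polyC scalerA.
(* As [p a = 1], the polynomial [h] divides 1 and is constant. Its coefficient of degree [D > 0] is
   the edge relation at [q'], which is nonzero. *)
rewrite /H /= /p qa q'a scale0r addr0 expr1n dvdp1 => /eqP hs.
have hD : h`_D = Q q' 0 - Q q' 1.
  by rewrite coefB /altprod !(coef_prod_linear (fun s => q (cyc _ (_ + s.*2)))
     (fun s => q' (cyc _ (_ + s.*2)))).
by case: Qq'; apply/eqP; rewrite -subr_eq0 -hD nth_default // hs.
Qed.

End GoodPoints.

(** * Pencils of edges *)

(** Serves for a closed walk: if [c t = c 0], the difference of the two products multiplies [c 0]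
    into [N]. *)
Lemma telescope_mod (A : comNzRingType) (N : set A) (a b c : nat -> A) t : is_ideal N ->
    (forall s, N (a s * c s - b s * c s.+1)) ->
  N ((\prod_(s < t) a s) * c 0%N - (\prod_(s < t) b s) * c t).
Proof.
move=> iN abc; elim: t => [|t IH].
  by rewrite !big_ord0 subrr; apply: is_ideal0.
rewrite !big_ord_recr /=.
set x := \prod_(i < t) a i in IH *; set y := \prod_(i < t) b i in IH *.
have -> : x * a t * c 0%N - y * b t * c t.+1 =
    a t * (x * c 0%N - y * c t) + y * (a t * c t - b t * c t.+1) by ring.
by apply: is_idealD => //; apply: is_idealMl.
Qed.

(** The induction step for multiplying congruences [x = b * a] and [y = b' * u]. *)
Lemma mulrB_expand (A : comNzRingType) (x y b b' a u : A) :
  x * y - b * b' * (a * u) = (x - b * a) * y + b * (a * (y - b' * u)).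
Proof. by ring. Qed.

Section Pencils.
Variables (D : nat) (D_gt0 : (0 < D)%N) (k : fieldType).
Local Notation d := D.*2.
Local Notation I := (cycle_edge_ideal k d).
Local Notation M := (maximal_ideal k d).
Local Notation Q := (altprod D_gt0).
Local Notation ledge i := (toLocal (edge k i)).
Local Notation cl := (const_local d).
Implicit Types (p q : 'I_d -> k) (J : set (localPoly k d)) (v : 'rV[k]_d).

Lemma altprod_neq_ex p : Q p 0 <> Q p 1 -> exists a, p a != 0.
Proof.
move=> Qp; apply: contrapT => p0; apply: Qp.
suff pE l : Q p l = 0 by rewrite !pE.
rewrite /altprod (bigD1 (Ordinal D_gt0)) //= [p _](_ : _ = 0) ?mul0r //.
by apply/eqP; apply: contrapT => /negP pa; apply: p0; exists (cyc D_gt0 (l + 0)).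
Qed.

Lemma const_local_div (N : set (localPoly k d)) c x : is_ideal N -> c != 0 ->
  N (cl c * x) -> N x.
Proof.
move=> iN c0 Nx; rewrite -[x]mul1r -(rmorph1 cl) -(mulVf c0) rmorphM -mulrA.
exact: is_idealMl.
Qed.

Lemma const_local_altprod p l :
  \prod_(s < D) cl (p (cyc D_gt0 (l + s.*2))) = cl (Q p l).
Proof. by rewrite rmorph_prod. Qed.

Lemma edge_cross (i : 'I_d) :
  toLocal 'X_i * ledge (ordS i) = toLocal 'X_(ordS (ordS i)) * ledge i.
Proof. by rewrite /edge !rmorphM [RHS]mulrC mulrA. Qed.

(* Modulo N, the products x_l e_i are p_i u_l for a vector u, and
   x_i e_(i+1) = x_(i+2) e_i then gives p_(i+1) u_i = p_i u_(i+2). *)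
Lemma pencil_mod p (N : set (localPoly k d)) : is_ideal N -> Q p 0 <> Q p 1 ->
    (forall l i j, N (toLocal 'X_l * (cl (p j) * ledge i - cl (p i) * ledge j))) ->
  forall l i, N (toLocal 'X_l * ledge i).
Proof.
move=> iN Qp pN; have [a pa] := altprod_neq_ex Qp.
pose u l := toLocal 'X_l * ledge a.
have pu l i : N (cl (p a) * (toLocal 'X_l * ledge i) - cl (p i) * u l).
  by have := pN l i a; rewrite mulrBr ![toLocal 'X_l * (cl _ * _)]mulrCA.
have uu i : N (cl (p (ordS i)) * u i - cl (p i) * u (ordS (ordS i))).
  have := is_idealB iN (pu (ordS (ordS i)) i) (pu i (ordS i)).
  by rewrite edge_cross opprB addrC addrA subrK.
have Nu l : N (u l).
  rewrite -(cyc_val D_gt0 l); move: (nat_of_ord l) => {}l.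
  pose ix s := cyc D_gt0 (l + s.*2).
  have := @telescope_mod _ N (fun s => cl (p (cyc D_gt0 (l.+1 + s.*2))))
    (fun s => cl (p (ix s))) (fun s => u (ix s)) D iN.
  (* After [D] steps of 2 the walk is back at its start, so the chained relations make the nonzero
     constant [Q p l.+1 - Q p l] multiply the value of [u] there into [N]. *)
  rewrite !const_local_altprod /ix cycDd addn0 -mulrBl -rmorphB => H.
  apply: (const_local_div iN _ (H _)).
    by rewrite subr_eq0 eq_sym; apply/eqP/altprod_neqS.
  move=> s; have := uu (cyc D_gt0 (l + s.*2)).
  by rewrite !ordS_cyc doubleS !addnS addSn.
move=> l i; apply: (const_local_div iN pa).
rewrite -[X in N X](subrK (cl (p i) * u l)); apply: is_idealD => //.
exact: is_idealMl.
Qed.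

(** The products of a variable and an edge generate [M I]. They satisfy the relations of
    [pencil_mod] modulo [J + M (M I)], so Nakayama's lemma applies. *)
Lemma pencil_max_edge p J : is_ideal J -> Q p 0 <> Q p 1 ->
    (forall i j, ideal_add J (ideal_mul M I) (cl (p j) * ledge i - cl (p i) * ledge j)) ->
  ideal_mul M I `<=` J.
Proof.
move=> iJ Qp Jp; have iM := @is_ideal_maximal k d.
pose s := [seq toLocal 'X_l * ledge i | l <- enum 'I_d, i <- enum 'I_d].
have iS : is_ideal (span_seq s) by apply: is_ideal_gen.
have MIs : ideal_mul M I `<=` span_seq s.
  apply: ideal_mul_sub => // a b Ma Ib.
  pose K1 := [set x | span_seq s (b * x)].
  suff : K1 a by rewrite /K1 /= mulrC.
  move: a Ma; apply: ideal_gen_sub; first exact: is_ideal_preim.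
  move=> _ [l _ <-]; rewrite /K1 /= mulrC.
  move: b Ib {K1}; apply: (ideal_gen_sub (J := [set x | span_seq s (toLocal 'X_l * x)])).
    exact: is_ideal_preim.
  move=> _ [i _ <-]; apply: ideal_gen_mem => /=.
  by apply/allpairsP; exists (l, i); rewrite !mem_enum.
have sJ x : x \in s -> J x.
  move: x; apply: (nakayama iM iJ) => [c|x /allpairsP[[l i] [_ _ ->]] /=].
    exact: maximal_subr1_unit.
  set N := ideal_add _ _.
  have iN : is_ideal N by apply: is_ideal_add => //; apply: is_ideal_mul.
  move: l i; apply: (pencil_mod iN Qp) => l i j.
  have [y [z [Jy Mz ->]]] := Jp i j; exists (toLocal 'X_l * y), (toLocal 'X_l * z).
  split; [exact: is_idealMl | | exact: mulrDr].
  apply: ideal_mul_mem; last exact: MIs.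
  by apply: ideal_gen_mem; exists l.
by move=> z /MIs; apply: (ideal_gen_sub iJ sJ).
Qed.

Definition cross p i j : {mpoly k[d]} := p j *: edge k i - p i *: edge k j.

Lemma cross_local p i j :
  toLocal (cross p i j) = cl (p j) * ledge i - cl (p i) * ledge j.
Proof. by rewrite /cross -!mul_mpolyC rmorphB !rmorphM. Qed.

(** For nonzero [p] the coefficient vectors of these generators span the hyperplane orthogonal to
    [p]; taking all pairs avoids choosing a nonzero coordinate. *)
Definition pencil p := ideal_gen (@toLocal k d @` [set f | exists i j, f = cross p i j]).

Lemma is_ideal_pencil p : is_ideal (pencil p). Proof. exact: is_ideal_gen. Qed.

Lemma pencil_mem p i j : pencil p (cl (p j) * ledge i - cl (p i) * ledge j).
Proof.
rewrite -cross_local; apply: ideal_gen_mem.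
by exists (cross p i j) => //; exists i, j.
Qed.

Lemma pencil_sub_ideal p J : is_ideal J ->
  (forall i j, J (cl (p j) * ledge i - cl (p i) * ledge j)) -> pencil p `<=` J.
Proof.
move=> iJ Jp; apply: ideal_gen_sub => // _ [_ [i [j ->]] <-].
by rewrite cross_local.
Qed.

Lemma pencil_edge p : pencil p `<=` I.
Proof.
apply: pencil_sub_ideal => [|i j]; first exact: is_ideal_edge.
by apply: (is_idealB (@is_ideal_edge _ _)); apply: (is_idealMl _ (@is_ideal_edge _ _));
  apply: ledge_in.
Qed.

Lemma homogeneous_pencil p : homogeneous_ideal (pencil p).
Proof.
exists [set f | exists i j, f = cross p i j] => // f [i [j ->]]; exists 2%N.
by apply: rpredB; apply: rpredZ; apply: edge_homog.
Qed.

Lemma dotD v w p : dot (v + w) p = dot v p + dot w p.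
Proof. by rewrite -big_split; apply: eq_bigr => i _; rewrite mxE mulrDl. Qed.

Lemma dotZ c v p : dot (c *: v) p = c * dot v p.
Proof. by rewrite mulr_sumr; apply: eq_bigr => i _; rewrite mxE mulrA. Qed.

Lemma dot_delta p (i : 'I_d) : dot (delta_mx 0 i) p = p i.
Proof.
rewrite /dot (bigD1 i) //= mxE !eqxx mul1r big1 ?addr0 // => j /negPf ji.
by rewrite mxE ji andbF mul0r.
Qed.

(** The generators of the pencil have coefficient vectors orthogonal to [p], so they lie in [J]
    modulo [M I], and in [J] itself once [M I] does. *)
Lemma reduction_initial J p : is_reduction I J -> Q p 0 <> Q p 1 ->
    (forall v, dot v p = 0 -> initial_space J v) ->
  ideal_mul M I `<=` J /\ pencil p `<=` J.
Proof.
move=> [iJ _ _] Qp pJ; have iMI := is_ideal_mul M I.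
have Jp i j : ideal_add J (ideal_mul M I) (cl (p j) * ledge i - cl (p i) * ledge j).
  have [|z Jz zv] := pJ (p j *: delta_mx 0 i + - p i *: delta_mx 0 j).
    by rewrite dotD !dotZ !dot_delta mulNr mulrC subrr.
  rewrite -mulNr -rmorphN -!comb_delta -!combZ -combD.
  exists z, (comb (p j *: delta_mx 0 i + - p i *: delta_mx 0 j) - z); split=> //.
    by rewrite -opprB; apply: (is_idealN iMI).
  by rewrite [RHS]addrC subrK.
have MIJ := pencil_max_edge iJ Qp Jp; split=> //.
by apply: pencil_sub_ideal => // i j; apply: (ideal_add_sub iJ _ MIJ (Jp i j)).
Qed.

Lemma max_edge_sub_reduction J : is_reduction I J -> ideal_mul M I `<=` J.
Proof.
move=> redJ; have [p Qp pJ] := reduction_point D_gt0 redJ.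
by have [] := reduction_initial redJ Qp pJ.
Qed.

(** Modulo the pencil every edge is a multiple of a single one. Its power [D] therefore generates
    [I^D] modulo the pencil times [I^(D-1)], and the relation of degree [D] between the edges
    absorbs that power. *)
Lemma pencil_reduction p : Q p 0 <> Q p 1 -> is_reduction I (pencil p).
Proof.
move=> Qp; have [a pa] := altprod_neq_ex Qp.
split; [exact: is_ideal_pencil | exact: pencil_edge | exists D.-1].
set P := pencil p; have iP : is_ideal P := is_ideal_pencil p.
have iPI r : is_ideal (ideal_mul P (ideal_exp I r)) by apply: is_ideal_mul.
apply/seteqP; split; last exact: ideal_mulS (@pencil_edge p) (@subset_refl _ _).
pose c i := cl (p i / p a).
have Pe i : P (ledge i - c i * ledge a).
  apply: (const_local_div iP pa); rewrite mulrBr mulrA -rmorphM /=.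
  by rewrite mulrCA divff // mulr1; apply: pencil_mem.
set ea := ledge a in Pe *.
have prodI (idx : nat -> 'I_d) t : ideal_exp I t (\prod_(s < t) ledge (idx s)).
  elim: t => [|t IH] //; rewrite big_ord_recr /= mulrC.
  apply: ideal_mul_mem IH; exact: ledge_in.
have prodP (idx : nat -> 'I_d) t : ideal_mul P (ideal_exp I t)
    ((\prod_(s < t.+1) ledge (idx s)) - (\prod_(s < t.+1) c (idx s)) * ea ^+ t.+1).
  elim: t => [|t IH].
    rewrite !big_ord1 expr1 -[X in ideal_mul _ _ X]mulr1.
    exact: ideal_mul_mem.
  rewrite big_ord_recr [X in _ - X * _]big_ord_recr /= exprS.
  rewrite [X in X - _]mulrC [X in X * (ea * _)]mulrC.
  rewrite mulrB_expand; apply: (is_idealD (iPI t.+1)).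
    exact: ideal_mul_mem (Pe _) (prodI _ _).
  apply: (is_idealMl _ (iPI t.+1)); apply: ideal_mul_expS IH; exact: ledge_in.
have DE : D = D.-1.+1 by rewrite prednK.
have cQ l : \prod_(s < D) c (cyc D_gt0 (l + s.*2)) = cl (Q p l / p a ^+ D).
  by rewrite -rmorph_prod big_split /= prodr_const card_ord exprVn.
(* The products of the even and of the odd edges coincide, so subtracting their two expansions
   leaves [ea ^+ D] times the nonzero constant [(Q p 0 - Q p 1) / p a ^+ D]. *)
have eaD : ideal_mul P (ideal_exp I D.-1) (ea ^+ D).
  have lQ : Q (fun i : 'I_d => ledge i) 0 = Q (fun i : 'I_d => ledge i) 1.
    transitivity (Q (fun i : 'I_d => toLocal ('X_i : {mpoly k[d]}) * toLocal 'X_(ordS i)) 0).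
      by apply: eq_bigr => s _; rewrite /edge rmorphM.
    rewrite altprod_edges; apply: eq_bigr => s _; by rewrite /edge rmorphM.
  have QP l : ideal_mul P (ideal_exp I D.-1)
      (Q (fun i : 'I_d => ledge i) l - cl (Q p l / p a ^+ D) * ea ^+ D).
    by have := prodP (fun s => cyc D_gt0 (l + s.*2)) D.-1; rewrite -DE cQ.
  have := is_idealB (iPI D.-1) (QP 1%N) (QP 0%N).
  rewrite lQ opprB addrC addrA subrK -mulrBl -rmorphB -mulrBl.
  apply: const_local_div => //.
  by rewrite mulf_neq0 ?invr_eq0 ?expf_neq0 // subr_eq0; apply/eqP.
(* [K t] is the sum of [P I^t] and the ideal of [ea ^+ t.+1]; it will contain [I^(t+1)]. *)
pose K t := [set z | exists b, ideal_mul P (ideal_exp I t) (z - b * ea ^+ t.+1)].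
have iK t : is_ideal (K t).
  split.
  - by exists 0; rewrite mul0r subr0; apply: is_ideal0 (iPI t).
  - move=> x y [b xb] [b' yb]; exists (b + b').
    by rewrite mulrDl opprD addrACA; apply: (is_idealD (iPI t)).
  - move=> r x [b xb]; exists (r * b).
    by rewrite -mulrA -mulrBr; apply: (is_idealMl _ (iPI t)).
have IP x : I x -> exists b, P (x - b * ea).
  pose L := [set x | exists b, P (x - b * ea)].
  apply: (ideal_gen_sub (J := L)); last by move=> _ [i _ <-]; exists (c i); apply: Pe.
  split.
  - by exists 0; rewrite mul0r subr0; apply: is_ideal0 iP.
  - move=> {}x y [b xb] [b' yb]; exists (b + b').
    by rewrite mulrDl opprD addrACA; apply: (is_idealD iP).
  - move=> r {}x [b xb]; exists (r * b).
    by rewrite -mulrA -mulrBr; apply: (is_idealMl _ iP).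
have IK t : ideal_exp I t.+1 `<=` K t.
  elim: t => [|t IH]; apply: ideal_mul_sub => // x y /IP[b xb] Iy.
    exists (y * b); rewrite expr1 -mulrA [x * y]mulrC -mulrBr mulrC.
    exact: ideal_mul_mem.
  have [b' yb'] := IH y Iy; exists (b * b').
  rewrite exprS mulrB_expand; apply: (is_idealD (iPI t.+1)).
    exact: ideal_mul_mem.
  apply: (is_idealMl _ (iPI t.+1)); apply: ideal_mul_expS yb'; exact: ledge_in.
move=> z /IK[b]; rewrite -DE => zb.
rewrite -[z](subrK (b * ea ^+ D)); apply: (is_idealD (iPI D.-1)) => //.
exact: (is_idealMl _ (iPI D.-1)).
Qed.

(* The coordinate points lie on the toric hypersurface because D > 1, and
   evaluating there isolates the entries of v. *)
Lemma comb_order3 v : (1 < D)%N -> order_ideal 3 (comb v) -> v = 0.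
Proof.
move=> D_gt1 v3; apply/rowP => a; rewrite [RHS]mxE.
have v0 : edge_map (lin v) = 0.
  by apply: (order_ideal_homog_eq0 _ v3); apply: (edge_map_homog (r := 1)); apply: lin_homog.
pose p i : k := (i == a)%:R.
have Qp l : Q p l = 0.
  suff [s sa] : exists s : 'I_D, cyc D_gt0 (l + s.*2) != a.
    by rewrite /altprod (bigD1 s) //= /p (negPf sa) mul0r.
  have [ca|ca] := eqVneq (cyc D_gt0 (l + 0)) a; last by exists (Ordinal D_gt0).
  (* The factor [s = 1] then works, as [l] and [l + 2] differ modulo [d] when [D > 1]. *)
  exists (Ordinal D_gt1); apply: contraTN isT => /eqP; rewrite -ca.
  move=> /(congr1 val) /= /eqP; rewrite addn0 -{2}[l]addn0 eqn_modDl.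
  by rewrite !modn_small //; lia.
have i0 : is_ideal [set (0 : k)].
  by split=> [|x y /= -> ->|x y /= ->]; rewrite ?addr0 ?mulr0.
have : [set (0 : k)] (mmap idfun p (lin v)).
  by apply: (edge_map_ker (D_gt0 := D_gt0) idfun) => //=; rewrite !Qp subrr.
rewrite mmap_lin (bigD1 a) //= /p eqxx mulr1 big1 ?addr0 // => i /negPf ->.
by rewrite mulr0.
Qed.

Lemma comb_order2 v : order_ideal 2 (comb v).
Proof. by apply: order_ideal_toLocal; apply: (edge_map_homog (r := 1)); apply: lin_homog. Qed.

(** By [comb_order3] the coordinate vector of an element modulo [M I] is unique, and an element of
    the pencil has one orthogonal to [p]. *)
Lemma pencil_dot p v z : (1 < D)%N -> pencil p z ->
  ideal_mul M I (z - comb v) -> dot v p = 0.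
Proof.
move=> D_gt1 pz /max_edge_order zv; have iO := @is_ideal_order k d 3.
pose K := [set z | exists2 w, dot w p = 0 & order_ideal 3 (z - comb w)].
have [w wp zw] : K z.
  move: pz; apply: pencil_sub_ideal => [|i j].
    split.
    - exists (0 *: 0); first by rewrite dotZ mul0r.
      by rewrite combZ rmorph0 mul0r subr0; apply: is_ideal0.
    - move=> x y [u up xu] [w wp yw]; exists (u + w); first by rewrite dotD up wp addr0.
      by rewrite combD opprD addrACA; apply: is_idealD.
    - move=> r x [w wp xw]; have [c /maximal_order_ideal1 rc] := residue r.
      exists (c *: w); first by rewrite dotZ wp mulr0.
      have -> : r * x - comb (c *: w) = r * (x - comb w) + (r - cl c) * comb w.
        by rewrite combZ mulrBr mulrBl addrA subrK.
      apply: is_idealD => //; first exact: is_idealMl.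
      exact: (order_idealM (M := 1)) (comb_order2 w).
  exists (p j *: delta_mx 0 i + - p i *: delta_mx 0 j).
    by rewrite dotD !dotZ !dot_delta mulNr mulrC subrr.
  rewrite combD !combZ !comb_delta rmorphN mulNr subrr; exact: is_ideal0.
suff -> : v = w by [].
apply/eqP; rewrite -subr_eq0; apply/eqP/comb_order3 => //.
rewrite combD -scaleN1r combZ rmorphN1 mulN1r.
have := is_idealB iO zw zv; rewrite opprB addrC addrA subrK.
by [].
Qed.

(** A smaller reduction contains the pencil of some good [q]. Vectors orthogonal to [q] are then
    orthogonal to [p], so [p] is a multiple of [q] and its pencil lies in that of [q]. *)
Lemma pencil_minimal p : (1 < D)%N -> Q p 0 <> Q p 1 ->
  is_minimal_reduction I (pencil p).
Proof.
move=> D_gt1 Qp; split=> [|J redJ Jp]; first exact: pencil_reduction.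
apply/seteqP; split=> //.
have [q Qq qJ] := reduction_point D_gt0 redJ.
have [_ qsub] := reduction_initial redJ Qq qJ.
have [b qb] := altprod_neq_ex Qq.
have pq i : p i * q b = p b * q i.
  have [|z Jz zv] := qJ (q b *: delta_mx 0 i + - q i *: delta_mx 0 b).
    by rewrite dotD !dotZ !dot_delta mulNr mulrC subrr.
  have := pencil_dot D_gt1 (Jp z Jz) zv.
  by rewrite dotD !dotZ !dot_delta mulNr mulrC [q i * _]mulrC => /subr0_eq.
apply: (subset_trans _ qsub).
apply: (pencil_sub_ideal (is_ideal_pencil q)) => i j.
have [e pE] : exists e, forall l, p l = e * q l.
  by exists (p b / q b) => l; rewrite mulrAC -pq mulfK.
have clM x : cl (e * x) = cl e * cl x by rewrite rmorphM.
rewrite (pE i) (pE j) !clM -![cl e * _ * _]mulrA -mulrBr.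
by apply: (is_idealMl _ (is_ideal_pencil q)); apply: pencil_mem.
Qed.

Lemma gradedcore_sub : (1 < D)%N -> gradedcore I `<=` ideal_mul M I.
Proof.
move=> D_gt1 z zg.
have zp p : Q p 0 <> Q p 1 -> pencil p z.
  move=> Qp; apply: zg; split; first exact: pencil_minimal.
  exact: homogeneous_pencil.
have d1 : (1 < d)%N by lia.
pose p2 (i : 'I_d) : k := (odd i == false)%:R.
have Q1 : Q p2 0 <> Q p2 1.
  by apply: (@altprod_neq_of_parity _ _ _ _ false (Ordinal d1)) => // i; rewrite /p2 => ->.
(* A single good point already places [z] in [I], which yields coordinates [v]; these are then
   orthogonal to all good points. *)
have [v zv] := edge_ideal_comb (pencil_edge (zp _ Q1)).
have v0 p : Q p 0 <> Q p 1 -> dot v p = 0.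
  by move=> Qp; apply: (pencil_dot D_gt1 (zp p Qp)).
suff vE : v = 0.
  move: zv; rewrite vE -(scale0r (0 : 'rV[k]_d)) combZ rmorph0 mul0r subr0.
  by [].
apply/rowP => j; rewrite mxE.
(* The points [p0] and [p1] differ by the unit vector at [j]. Both are 1 at the indices of parity
   opposite to [j] and vanish at [j + 2], which differs from [j] because [D > 1], so both are
   good. *)
pose p0 (i : 'I_d) : k := (odd i == ~~ odd j)%:R.
pose p1 (i : 'I_d) : k := p0 i + (i == j)%:R.
pose i0 := cyc D_gt0 (j + 2).
have oi0 : odd i0 = odd j.
  by rewrite /= odd_mod ?odd_double // oddD addbF.
have i0j : i0 != j.
  apply: contraTN isT => /eqP /(congr1 val) /= ij.
  have /eqP : ((j + 2) %% d = (j + 0) %% d)%N by rewrite ij addn0 modn_small.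
  by rewrite eqn_modDl !modn_small //; lia.
have Qp0 : Q p0 0 <> Q p0 1.
  apply: (@altprod_neq_of_parity _ _ _ _ (~~ odd j) i0).
  - by move=> i oi; rewrite /p0 oi eqxx.
  - by rewrite oi0 negbK.
  - by rewrite /p0 oi0; case: (odd j).
have Qp1 : Q p1 0 <> Q p1 1.
  apply: (@altprod_neq_of_parity _ _ _ _ (~~ odd j) i0).
  - move=> i oi; rewrite /p1 /p0 oi eqxx; case: eqP => [ij|]; last by rewrite addr0.
    by move: oi; rewrite ij; case: (odd j).
  - by rewrite oi0 negbK.
  - by rewrite /p1 /p0 oi0 (negPf i0j) addr0; case: (odd j).
have : dot v p1 - dot v p0 = v 0 j.
  rewrite -sumrB (bigD1 j) //= big1 => [|i /negPf ij].
    by rewrite /p1 eqxx addr0 -mulrBr addrC addrA addNr add0r mulr1.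
  by rewrite /p1 ij addr0 subrr.
by rewrite !v0 // subrr.
Qed.

Lemma core_cycle : (1 < D)%N ->
  core I = gradedcore I /\ gradedcore I = ideal_mul M I.
Proof.
move=> D_gt1.
have cg : core I `<=` gradedcore I by move=> z zc J [[redJ _] _]; apply: zc.
have gm := gradedcore_sub D_gt1.
have mc : ideal_mul M I `<=` core I by move=> z zm J /max_edge_sub_reduction; apply.
by split; apply/seteqP; split=> // z; [move/gm/mc | move/mc/cg].
Qed.

End Pencils.

Local Close Scope ring_scope.
Local Close Scope classical_set_scope.

Theorem mainTheorem5 (k : fieldType) (d : nat) :
  infinite_set [set: k]%classic -> 4 <= d -> ~~ odd d ->
  let I := cycle_edge_ideal k d in
  core I = gradedcore I /\
  gradedcore I = ideal_mul (maximal_ideal k d) I.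
Proof.
move=> _ d4 dE; have D_gt1 : (1 < d./2)%N by lia.
have <- : d./2.*2 = d by rewrite even_halfK.
exact: (core_cycle (ltnW D_gt1)) D_gt1.
Qed.
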